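(* For every integer $w > 3$ there exists a (finite) poset $P_w$ of width $w$ with \[ \operatorname{qn}(P_w) \geq \frac{w^2}{8}. \]
   Context: A poset $P=(X,<)$ is a finite set $X$ with a transitive, antisymmetric (strict) order relation $<$. A relation $a<b$ is a cover relation if there is no $c$ with $a<c<b$; the cover edges of $P$ are the pairs $(a,b)$ with $a<b$ a cover relation. The width of $P$ is the maximum number of pairwise incomparable elements. A linear extension $L$ of $P$ is a total order on $X$ such that $a<b$ in $P$ implies $a<b$ in $L$. Given a linear order $L$ of $X$, a $k$-rainbow is a set of $k$ cover edges $\{a_ib_i : 1\le i\le k\}$ with $a_1<a_2<\cdots<a_k<b_k<\cdots<b_2<b_1$ in $L$. The queue-number $\operatorname{qn}(P)$ of $P$ is the smallest $k$ such that there is a linear extension $L$ of $P$ in which the cover edges of $P$ contain no $(k+1)$-rainbow (equivalently, the cover edges can be partitioned into $k$ sets, none containing two edges forming a $2$-rainbow). *)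

(* Defs.v *)
From HB Require Import structures.
From mathcomp Require Import all_boot all_order all_algebra.
From mathcomp Require Import boolp.

Set Implicit Arguments.
Unset Strict Implicit.
Unset Printing Implicit Defensive.

Import Order.TTheory.

Local Open Scope order_scope.

Section Poset.
Context {d : Order.disp_t} (P : finPOrderType d).

Definition antichain (A : {set P}) : bool :=
  [forall x in A, forall y in A, (x != y) ==> (x >< y)].

Definition width : nat := (\max_(A : {set P} | antichain A) #|A|)%N.

Definition cover_edge (a b : P) : bool :=
  (a < b) && ~~ [exists c : P, a < c < b].

(* L x y is the strict comparison of x and y in the total order. *)
Definition linear_extension (L : rel P) : Prop :=
  [/\ irreflexive L, transitive L,
      forall x y : P, x != y -> L x y || L y x
    & forall x y : P, x < y -> L x y].

(* The list a ++ rev b is a_1, ..., a_k, b_k, ..., b_1. *)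
Definition rainbow (L : rel P) (k : nat) (a b : k.-tuple P) : bool :=
  all2 cover_edge a b && sorted L (a ++ rev b).

Definition queue_layout (k : nat) : Prop :=
  exists2 L : rel P, linear_extension L
    & ~ exists a b : k.+1.-tuple P, rainbow L a b.

Lemma linear_extension_exists : exists L : rel P, linear_extension L.
Proof.
pose h (x : P) := #|[set z : P | z < x]|.
exists (fun x y => (h x < h y)%N || (h x == h y) && (enum_rank x < enum_rank y)%N).
split.
- by move=> x; rewrite !ltnn andbF.
- move=> y x z /orP[xy|/andP[/eqP xy rxy]] /orP[yz|/andP[/eqP yz ryz]].
  + by rewrite (ltn_trans xy yz).
  + by rewrite -yz xy.
  + by rewrite xy yz.
  + by rewrite xy yz eqxx (ltn_trans rxy ryz) orbT.
- move=> x y nxy; case: (ltngtP (h x) (h y)) => //= _.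
  have : enum_rank x != enum_rank y by rewrite (inj_eq enum_rank_inj).
  by rewrite -val_eqE /= neq_ltn.
- move=> x y xy; apply/orP; left; apply: proper_card; apply/properP; split.
    by apply/subsetP => z; rewrite !inE => /lt_trans; apply.
  by exists x; rewrite inE ?ltxx.
Qed.

Lemma queue_layout_exists : exists k, `[< queue_layout k >].
Proof.
have [L Lext] := linear_extension_exists; have [Lirr Ltr _ _] := Lext.
exists #|P|; apply/asboolP; exists L => // -[a [b /andP[_]]].
move=> /(sorted_uniq Ltr Lirr); rewrite cat_uniq => /andP[/card_uniqP ca _].
by have := max_card (mem a); rewrite ca size_tuple ltnn.
Qed.

Definition queue_number : nat := ex_minn queue_layout_exists.

End Poset.

(* Main.v *)
Require Import Defs.
From HB Require Import structures.
From mathcomp Require Import all_boot all_order all_algebra.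
From mathcomp Require Import boolp zify.

Import Order.TTheory GRing.Theory Num.Theory.

(** There are [r + 1] row chains, indexed by a common time, and [n] column
    chains, with one cover edge from each row element to each column.  Time is
    a tree of depth [n]: the nodes of level [m] are the blocks of [M ^ m]
    consecutive times.  Column [j] receives its edges node by node at level
    [j + 1], and row by row inside a node.

    Fix a linear extension [L] and look at the children of a node of level
    [m + 1].  If [L] keeps a set of consecutive rows synchronized along the
    children, then the edges of these rows to column [m] form a rainbow, one
    edge per row in decreasing order of the rows, and it can be arranged around
    a rainbow of columns [< m] found in one child; at most one row is lost,
    namely the one whose part of column [m] surrounds the right ends of that
    child.  Otherwise [L] separates the set into two smaller ones during a long
    time, and the rainbow of the lower rows in a late child encloses the
    rainbow of the upper rows in an early one.  Only [r] separations are
    possible, so about [r n - r ^ 2 / 2] of the [(r + 1) n] pairs of a row and a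
    column survive; with [r = w / 3] and [n = w - r - 1] this is about
    [w ^ 2 / 6].  One extra edge per set of rows is gained for free by inserting
    further elements into the chain of the last row. *)

Set Implicit Arguments.
Unset Strict Implicit.
Unset Printing Implicit Defensive.

(** * Lexicographic comparison of keys *)

Fixpoint lexlt (s t : seq nat) : bool :=
  match s, t with
  | x :: s', y :: t' => (x < y) || (x == y) && lexlt s' t'
  | _, _ => false
  end.

Lemma lexlt_irr s : lexlt s s = false.
Proof. by elim: s => //= x s ->; rewrite ltnn andbF. Qed.

Lemma lexlt_trans : transitive lexlt.
Proof.
elim=> [|y t IH] [|x s] [|z u] //=.
move=> /orP[xy|/andP[/eqP-> st]] /orP[yz|/andP[/eqP<- tu]].
- by rewrite (ltn_trans xy yz).
- by rewrite xy.
- by rewrite yz.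
- by rewrite eqxx (IH _ _ st tu) orbT.
Qed.

(** * The tree of times *)

Section Node.
Context (M : nat) (M_gt0 : 0 < M).

Definition node m s := s %/ M ^ m.

Definition node_end m s := ((node m s).+1 * M ^ m).-1.

Lemma node_le m s s' : s <= s' -> node m s <= node m s'.
Proof. exact: leq_div2r. Qed.

Lemma node_lt m s s' : node m s < node m s' -> s < s'.
Proof. by rewrite !ltnNge; apply: contra => /node_le. Qed.

Lemma node_node j m s : node m (node j s) = node (j + m) s.
Proof. by rewrite /node -divnMA expnD. Qed.

Lemma node_lt_sub j m s s' : j <= m -> node m s < node m s' -> node j s < node j s'.
Proof. by move=> jm; rewrite -(subnKC jm) -!node_node => /node_lt. Qed.

Lemma node_end_lt j s s' : (node_end j s < s') = (node j s < node j s').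
Proof.
rewrite /node_end [RHS]leq_divRL ?expn_gt0 ?M_gt0 //.
by rewrite prednK // muln_gt0 expn_gt0 M_gt0.
Qed.

Lemma node_end_ge j s : s <= node_end j s.
Proof. by rewrite leqNgt node_end_lt ltnn. Qed.

Lemma node_node_end j m s : j <= m -> node m (node_end j s) = node m s.
Proof.
move=> jm; apply/eqP; rewrite eqn_leq [X in _ && X]node_le ?node_end_ge // andbT.
by rewrite leqNgt; apply/negP => /(node_lt_sub jm); rewrite -node_end_lt ltnn.
Qed.

Lemma node_end_le j s s' : node j s <= node j s' -> node_end j s <= node_end j s'.
Proof. by rewrite /node_end => h; rewrite -!subn1 leq_sub2r // leq_mul2r ltnS h orbT. Qed.

Lemma node_end_ltn j s s' : node j s < node j s' -> node_end j s < node_end j s'.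
Proof. by rewrite -node_end_lt => /leq_trans; apply; exact: node_end_ge. Qed.

End Node.

(* The summands are the row elements, the additional elements of the chain of
   the last row (one after each time) and the column elements [(j, i, s)], where
   [(j, i, s)] is the upper end of the edge from the element of row [i] at time
   [s] to column [j]. *)
Definition elt (r n M : nat) : Type :=
  ('I_r.+1 * 'I_(M ^ n).+1 + 'I_(M ^ n).+1
   + 'I_n * 'I_r.+1 * 'I_(M ^ n).+1)%type.

HB.instance Definition _ r n M := Finite.on (elt r n M).

(** * The order relation *)

Section Poset.
Context (r n M : nat).
Local Notation elt := (elt r n M).
Local Notation node := (node M).
Local Notation node_end := (node_end M).

(* The order is the intersection of the weak orders given by the keys.  In
   [key (Some l)] nothing separates the ends of an edge to column [l], and every
   other column comes as late as the end of the current node of its own level.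
   [key None] reverses the rows, which makes simultaneous row elements
   incomparable. *)
Definition key (o : option 'I_n) (x : elt) : seq nat :=
  match o, x with
  | None, inl (inl (i, s)) => [:: val s; r - i]
  | None, inl (inr s) => [:: val s; r.+1]
  | None, inr (j, i, s) => [:: node_end j.+1 s; r.+2; val i; val s]
  | Some l, inl (inl (i, s)) => [:: node l.+1 s; val i; val s; 0]
  | Some l, inl (inr s) => [:: node l.+1 s; r; val s; 2]
  | Some l, inr (j, i, s) =>
      if l == j then [:: node l.+1 s; val i; val s; 1]
      else [:: node l.+1 (node_end j.+1 s); r; node_end j.+1 s; 3; val i; val s]
  end.

Definition elt_lt (x y : elt) := [forall o, lexlt (key o x) (key o y)].

Lemma elt_lt_irr : irreflexive elt_lt.
Proof. by move=> x; apply/negP => /forallP/(_ None); rewrite lexlt_irr. Qed.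

Lemma elt_lt_trans : transitive elt_lt.
Proof.
move=> y x z /forallP xy /forallP yz; apply/forallP => o.
exact: lexlt_trans (xy o) (yz o).
Qed.

End Poset.

HB.instance Definition _ r n M :=
  @Order.Lt_isPOrder.Build (Order.Disp tt tt) (elt r n M) (@elt_lt r n M)
    (@elt_lt_irr r n M) (@elt_lt_trans r n M).

(** * Comparabilities and cover edges *)

Section Relations.
Context (r n M : nat).
Local Notation elt := (elt r n M).
Local Notation node := (node M).
Local Notation node_end := (node_end M).
Local Notation row i s := (inl (inl (i, s)) : elt).
Local Notation top s := (inl (inr s) : elt).
Local Notation col j i s := (inr (j, i, s) : elt).

Lemma elt_ltP (x y : elt) :
  reflect (forall o, lexlt (key o x) (key o y)) (x < y)%O.
Proof. exact: forallP. Qed.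

Lemma row_lt_row (i i' : 'I_r.+1) (s s' : 'I_(M ^ n).+1) :
  i <= i' -> s < s' -> (row i s < row i' s')%O.
Proof.
move=> ii ss; apply/elt_ltP => -[l|] /=; last lia.
have := node_le M l.+1 (ltnW ss); lia.
Qed.

Lemma row_lt_top (i : 'I_r.+1) (s : 'I_(M ^ n).+1) : (row i s < top s)%O.
Proof. by have := ltn_ord i; move=> ?; apply/elt_ltP => -[l|] /=; lia. Qed.

Lemma top_lt_row (s s' : 'I_(M ^ n).+1) : s < s' -> (top s < row ord_max s')%O.
Proof.
move=> ss; apply/elt_ltP => -[l|] /=; last lia.
have := node_le M l.+1 (ltnW ss); lia.
Qed.

Lemma top_lt_top (s s' : 'I_(M ^ n).+1) : s < s' -> (top s < top s')%O.
Proof. by move=> ss; apply: lt_trans (top_lt_row ss) (row_lt_top _ _). Qed.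

Lemma col_lt_col_row (j : 'I_n) (i i' : 'I_r.+1) (s s' : 'I_(M ^ n).+1) :
  node j.+1 s = node j.+1 s' -> i < i' -> (col j i s < col j i' s')%O.
Proof.
move=> ss ii; have es : node_end j.+1 s = node_end j.+1 s' by rewrite /node_end ss.
apply/elt_ltP => -[l|] /=; last lia.
case: eqP => [->|_] /=; first lia.
rewrite es; lia.
Qed.

Lemma col_lt_col_time (j : 'I_n) (i : 'I_r.+1) (s s' : 'I_(M ^ n).+1) :
  s < s' -> (col j i s < col j i s')%O.
Proof.
move=> ss; have ns := node_le M j.+1 (ltnW ss); have es := node_end_le ns.
apply/elt_ltP => -[l|] /=; last lia.
have := node_le M l.+1 es.
case: eqP => [->|_] /=; lia.
Qed.

(** [key None] leaves only rows of smaller index at time [s] in between, and every [key (Some l)]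
    puts these before [row i s]; [0 < n] supplies such an [l]. *)
Lemma cover_row_top (i : 'I_r.+1) (s : 'I_(M ^ n).+1) :
  0 < n -> cover_edge (row i s) (top s).
Proof.
move=> n_gt0; rewrite /cover_edge row_lt_top /=; apply/negP => /existsP[c /andP[]].
move=> /elt_ltP acl /elt_ltP clb.
have := acl None; have := clb None.
have := acl (Some (Ordinal n_gt0)); have := clb (Some (Ordinal n_gt0)).
have := ltn_ord i.
case: c {acl clb} => [[[i' s']|s']|[[j' i'] s']] /=.
- have [->|] := eqVneq s' s; last rewrite -val_eqE /=; lia.
- lia.
- lia.
Qed.

Context (M_gt0 : 0 < M).

Lemma row_lt_col (j : 'I_n) (i : 'I_r.+1) (s : 'I_(M ^ n).+1) :
  (row i s < col j i s)%O.
Proof.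
have ri := ltn_ord i; have es := node_end_ge M_gt0 j.+1 s.
apply/elt_ltP => -[l|] /=; last lia.
have := node_le M l.+1 es; case: eqP => _ /=; lia.
Qed.

(** In [key (Some j)] the nodes of level [j.+1] already differ; in the other [key (Some l)] both
    elements carry [r] in second place, so time decides. *)
Lemma top_lt_col m (j : 'I_n) (i : 'I_r.+1) (s s' : 'I_(M ^ n).+1) :
  j < m -> node m s < node m s' -> (top s < col j i s')%O.
Proof.
move=> jm ss; have ns := node_lt_sub jm ss; have es := node_end_ltn M_gt0 ns.
have se := node_end_ge M_gt0 j.+1 s; have ss' := node_lt ns.
apply/elt_ltP => -[l|] /=; last lia.
have := node_le M l.+1 (ltnW es); have := node_le M l.+1 se.
case: eqP => [->|_] /=; lia.
Qed.

Lemma col_lt_top m (j : 'I_n) (i : 'I_r.+1) (s s' : 'I_(M ^ n).+1) :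
  j < m -> node m s < node m s' -> (col j i s < top s')%O.
Proof.
move=> jm ss; have ns := node_lt_sub jm ss.
have es : node_end j.+1 s < s' by rewrite node_end_lt.
apply/elt_ltP => -[l|] /=; last lia.
have := node_le M l.+1 (ltnW es).
case: eqP => [->|_] /=; lia.
Qed.

Lemma col_lt_col m (j j' : 'I_n) (i i' : 'I_r.+1) (s s' : 'I_(M ^ n).+1) :
  j < m -> j' < m -> node m s < node m s' -> (col j i s < col j' i' s')%O.
Proof.
move=> jm jm' ss; have ns := node_lt_sub jm ss; have ns' := node_lt_sub jm' ss.
have es : node_end j.+1 s < s' by rewrite node_end_lt.
have es' := node_end_ge M_gt0 j'.+1 s'.
have nn : node j'.+1 (node_end j.+1 s) < node j'.+1 s'.
  by apply: (node_lt_sub jm'); rewrite node_node_end.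
have nn' := node_le M j.+1 es'.
apply/elt_ltP => -[l|] /=; last lia.
have := node_le M l.+1 (leq_trans (ltnW es) es').
case: eqP => [->|_] /=; case: eqP => [?|_] /=; subst; lia.
Qed.

(** In [key (Some j)] the two ends differ only in the last entry, 0 against 1, so no third key fits
    between them. *)
Lemma cover_row_col (j : 'I_n) (i : 'I_r.+1) (s : 'I_(M ^ n).+1) :
  cover_edge (row i s) (col j i s).
Proof.
rewrite /cover_edge row_lt_col /=; apply/negP => /existsP[c /andP[]].
move=> /elt_ltP/(_ (Some j)) + /elt_ltP/(_ (Some j)).
rewrite /= eqxx; case: c => [[[i' s']|s']|[[j' i'] s']] /=; try lia.
case: eqP => _ /=; lia.
Qed.

End Relations.

(** * Width: a chain partition and an antichain *)

Section Width.
Context (r n M : nat) (M_gt1 : 1 < M) (n_gt0 : 0 < n).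
Local Notation elt := (elt r n M).
Local Notation row i s := (inl (inl (i, s)) : elt).
Local Notation top s := (inl (inr s) : elt).
Local Notation col j i s := (inr (j, i, s) : elt).

Let M_gt0 : 0 < M := ltnW M_gt1.

Definition chain_of (x : elt) : 'I_r.+1 + 'I_n :=
  match x with
  | inl (inl (i, _)) => inl i
  | inl (inr _) => inl ord_max
  | inr (j, _, _) => inr j
  end.

Lemma chain_ofP (x y : elt) : chain_of x = chain_of y -> (x >=< y)%O.
Proof.
rewrite /Order.comparable.
case: x => [[[i s]|s]|[[j i] s]]; case: y => [[[i' s']|s']|[[j' i'] s']] //=.
- move=> [<-].
  case: (ltngtP s s') => [ss|ss|/val_inj->]; rewrite ?lexx //.
    by rewrite (ltW (row_lt_row (leqnn i) ss)).
  by rewrite orbC (ltW (row_lt_row (leqnn i) ss)).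
- move=> [->].
  case: (ltngtP s s') => [ss|/top_lt_row/ltW->|/val_inj<-]; rewrite ?orbT //.
    by rewrite (ltW (lt_trans (row_lt_top _ _) (top_lt_top r ss))).
  by rewrite (ltW (row_lt_top _ _)).
- move=> [<-].
  case: (ltngtP s' s) => [ss|/top_lt_row/ltW->|/val_inj<-] //; rewrite orbC.
    by rewrite (ltW (lt_trans (row_lt_top _ _) (top_lt_top r ss))).
  by rewrite (ltW (row_lt_top _ _)).
- by move=> _; case: (ltngtP s s') => [/top_lt_top/ltW->|/top_lt_top/ltW->|/val_inj->];
    rewrite ?lexx ?orbT.
- move=> [<-].
  case: (ltngtP (node M j.+1 s) (node M j.+1 s')) => [ss|ss|ss].
  + by rewrite (ltW (col_lt_col M_gt0 _ _ (ltnSn j) (ltnSn j) ss)).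
  + by rewrite orbC (ltW (col_lt_col M_gt0 _ _ (ltnSn j) (ltnSn j) ss)).
  + case: (ltngtP i i') => [ii|ii|/val_inj <-].
    * by rewrite (ltW (col_lt_col_row ss ii)).
    * by rewrite orbC (ltW (col_lt_col_row (esym ss) ii)).
    * case: (ltngtP s s') => [lt_ss|lt_ss|/val_inj <-]; last by rewrite lexx.
        by rewrite (ltW (col_lt_col_time _ _ lt_ss)).
      by rewrite orbC (ltW (col_lt_col_time _ _ lt_ss)).
Qed.

Lemma node_end0_gt0 j : 0 < node_end M j.+1 0.
Proof.
rewrite /node_end /node div0n mul1n -ltnS prednK ?expn_gt0 ?M_gt0 //.
by rewrite (ltn_exp2l 0).
Qed.

(** At time 0, row 0 would lie below [col j ord0 ord0]. At time 1 every row follows that element in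
    [key (Some j)] and precedes it in [key None]. *)
Definition wide (u : 'I_r.+1 + 'I_n) : elt :=
  match u with
  | inl i => row i (inord 1)
  | inr j => col j ord0 ord0
  end.

Lemma wide_lt u v : (wide u < wide v)%O = false.
Proof.
have t1 : (inord 1 : 'I_(M ^ n).+1) = 1 :> nat by rewrite inordK // ltnS expn_gt0 M_gt0.
apply/negP => /elt_ltP.
case: u v => [i|j] [i'|j'] /= h.
- have := h None; have := h (Some (Ordinal n_gt0)); rewrite /= t1; lia.
- have := h (Some j'); rewrite /= eqxx t1 /node div0n divn_small ?(ltn_exp2l 0) //; lia.
- have := h None; have := node_end0_gt0 j; rewrite /= t1; lia.
- have := h (Some j'); have := node_end0_gt0 j; rewrite /= eqxx; case: eqP => _ /=; rewrite {2}/node div0n; lia.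
Qed.

Lemma width_elt : width (elt : finPOrderType _) = r.+1 + n.
Proof.
have cardI : #|{: 'I_r.+1 + 'I_n}| = r.+1 + n by rewrite card_sum !card_ord.
apply/eqP; rewrite eqn_leq /width -{1}cardI; apply/andP; split.
- apply/bigmax_leqP => S /forall_inP anti.
  rewrite -(card_in_imset (f := chain_of)) ?max_card // => x y xS yS /chain_ofP xy.
  apply/eqP; apply: contraLR xy => nxy.
  by have /forall_inP/(_ _ yS) := anti _ xS; rewrite nxy.
- have inj : injective wide by move=> [i|j] [i'|j'] // [->].
  rewrite -cardI -cardsT -(card_imset _ inj).
  apply: (leq_bigmax_cond (F := fun A : {set elt} => #|A|)).
  apply/forall_inP => x /imsetP[u _ ->]; apply/forall_inP => y /imsetP[v _ ->].
  apply/implyP => nuv; rewrite /Order.comparable !le_eqVlt !wide_lt !orbF.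
  by rewrite [_ == wide u]eq_sym orbb.
Qed.

End Width.

(** * Rainbows as lists of nested edges *)

Section Nest.
Context {d : Order.disp_t} (P : finPOrderType d) (L : rel P).

Definition nested (e f : P * P) := L e.1 f.1 && L f.2 e.2.

(* Edges are listed from the outermost to the innermost one. *)
Definition nest (es : seq (P * P)) :=
  all (fun e => cover_edge e.1 e.2) es && pairwise nested es.

Lemma nest_cat es fs : nest es -> nest fs -> {in es & fs, forall e f, nested e f} ->
  nest (es ++ fs).
Proof.
move=> /andP[es1 es2] /andP[fs1 fs2] ef; rewrite /nest all_cat es1 fs1.
by rewrite pairwise_cat es2 fs2 !andbT; apply/allrelP => e f; apply: ef.
Qed.

Lemma nest_take k es : nest es -> nest (take k es).
Proof.
rewrite -{1}(cat_take_drop k es) /nest all_cat pairwise_cat.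
by move=> /andP[/andP[-> _] /and3P[_ -> _]].
Qed.

Context (L_ext : linear_extension L).

Lemma nest_sorted es : nest es ->
  sorted L ([seq e.1 | e <- es] ++ rev [seq e.2 | e <- es]).
Proof.
have [_ L_tr _ L_lt] := L_ext; rewrite sorted_pairwise //.
have cov e : cover_edge e.1 e.2 -> L e.1 e.2 by move=> /andP[/L_lt].
elim: es => // e es IH /andP[/= /andP[/cov Le /allP es1] /andP[/allP ees es2]].
have {}IH : pairwise L ([seq e.1 | e <- es] ++ rev [seq e.2 | e <- es]).
  by apply: IH; rewrite /nest es2 andbT; apply/allP.
rewrite rev_cons -rcons_cat pairwise_rcons IH andbT all_rcons Le /=.
apply/andP; split; apply/allP => x; rewrite mem_cat mem_rev => /orP[] /mapP[f fes ->].
- by have /andP[] := ees _ fes.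
- have /andP[ef _] := ees _ fes; exact: L_tr ef (cov _ (es1 _ fes)).
- have /andP[_ fe] := ees _ fes; exact: L_tr (cov _ (es1 _ fes)) fe.
- by have /andP[] := ees _ fes.
Qed.

Lemma nest_rainbow k es : nest es -> k <= size es ->
  exists a b : k.-tuple P, rainbow L a b.
Proof.
move=> /(@nest_take k) nes kes.
have sz (f : P * P -> P) : size (map f (take k es)) == k by rewrite size_map size_takel.
exists (Tuple (sz fst)), (Tuple (sz snd)); apply/andP; split => /=; last exact: nest_sorted.
by have /andP[+ _] := nes; elim: (take k es) => //= e fs IH /andP[-> /IH].
Qed.

End Nest.

Lemma queue_number_ge {d : Order.disp_t} (P : finPOrderType d) k :
  (forall L : rel P, linear_extension L -> exists2 es, nest L es & k <= size es) ->
  k <= queue_number P.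
Proof.
move=> nestk; rewrite /queue_number; case: ex_minnP => q /asboolP[L Lext no_rainbow] _.
have [es nes kes] := nestk L Lext; rewrite leqNgt; apply/negP => qk.
exact: no_rainbow (nest_rainbow Lext nes (leq_trans qk kes)).
Qed.

(** * Rainbows confined to one node *)

Section Extension.
Context (r n M : nat) (M_gt0 : 0 < M) (n_gt0 : 0 < n).
Local Notation elt := (elt r n M).
Local Notation node := (node M).
Local Notation row i s := (inl (inl (i, s)) : elt).
Local Notation top s := (inl (inr s) : elt).
Local Notation col j i s := (inr (j, i, s) : elt).
Context (L : rel elt) (L_ext : @linear_extension _ (elt : finPOrderType _) L).

Let L_irr : irreflexive L. Proof. by case: L_ext. Qed.
Let L_tr : transitive L. Proof. by case: L_ext. Qed.
Let L_total x y : x != y -> L x y || L y x. Proof. by case: L_ext => _ _ + _; apply. Qed.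
Let L_lt x y : (x < y)%O -> L x y. Proof. by case: L_ext => _ _ _; apply. Qed.

Definition in_rows m u p q (x : elt) : bool :=
  if x is inl (inl (i, s)) then (p <= i < q) && (node m s == u) else false.

Definition in_tops m u (x : elt) : bool :=
  match x with
  | inl (inl _) => false
  | inl (inr s) => node m s == u
  | inr (j, _, s) => (j < m) && (node m s == u)
  end.

Definition nest_at m u p q k :=
  exists2 es, nest (L : rel (elt : finPOrderType _)) es &
    size es = k /\ all (fun e => in_rows m u p q e.1 && in_tops m u e.2) es.

(** Lets a rainbow of a late child enclose, on the right, one of an earlier child. *)
Lemma in_tops_lt m u u' x y : in_tops m u x -> in_tops m u' y -> u < u' -> L x y.
Proof.
case: x y => [[//|s]|[[j i] s]] [[//|s']|[[j' i'] s']] /=.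
- by move=> /eqP<- /eqP<- /node_lt ss; apply/L_lt/top_lt_top.
- by move=> /eqP<- /andP[jm' /eqP<-] ss; apply/L_lt/(top_lt_col M_gt0 _ jm' ss).
- by move=> /andP[jm /eqP<-] /eqP<- ss; apply/L_lt/(col_lt_top M_gt0 _ jm ss).
- by move=> /andP[jm /eqP<-] /andP[jm' /eqP<-] ss; apply/L_lt/(col_lt_col M_gt0 _ _ jm jm' ss).
Qed.

Lemma nest_at_le m u p q k k' : k' <= k -> nest_at m u p q k -> nest_at m u p q k'.
Proof.
move=> kk [es nes [sz /allP hes]]; exists (take k' es); first exact: nest_take.
split; first by rewrite size_takel ?sz.
by apply/allP => e /mem_take/hes.
Qed.

(** The free edge of each set of rows: at level 0 no column is available, only the additional
    element of time [s]. *)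
Lemma nest_at0 s p q : s <= M ^ n -> p < q <= r.+1 -> nest_at 0 s p q 1.
Proof.
move=> sN /andP[pq qr].
exists [:: (row (inord p) (inord s), top (inord s))].
  by rewrite /nest /= cover_row_top.
split=> //=; rewrite /node expn0 divn1 !inordK ?eqxx ?leqnn ?pq //.
exact: leq_trans qr.
Qed.

(** * From the children of a node to the node *)

Section Step.
(** The samples are the children [c (D * t)] with [t < D]: the two extremes, [r.+1] early ones,
    [r.+2] candidates for the middle and [r.+1] late ones. The gaps of length [D] absorb the drift
    between rows. *)
Let D := (3 * r + 6).
Context (m v : nat) (c : nat -> nat) (rho : nat -> nat -> nat).
Context (lt_mn : m < n) (v_le : v < M ^ (n - m.+1)).
Context (c_lt : forall k k', k < k' < D * D -> c k < c k').
Context (c_node : forall k, k < D * D -> c k %/ M = v).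
Context (c_nest : forall k, k < D * D ->
  forall p q, p < q <= r.+1 -> nest_at m (c k) p q (rho p q)).

Let time k : 'I_(M ^ n).+1 := inord (c k * M ^ m).
Let R i k : elt := row (inord i) (time k).
Let X i k : elt := col (Ordinal lt_mn) (inord i) (time k).

Let timeE k : k < D * D -> time k = c k * M ^ m :> nat.
Proof.
move=> kD; rewrite inordK // ltnS -(subnK lt_mn) expnD expnS mulnA.
rewrite leq_mul2r; apply/orP; right; apply: ltnW.
by rewrite -ltn_divLR // c_node.
Qed.

Let node_time k : k < D * D -> node m (time k) = c k.
Proof. by move=> kD; rewrite timeE // /node mulnK ?expn_gt0 ?M_gt0. Qed.

Let node_timeS k : k < D * D -> node m.+1 (time k) = v.
Proof. by move=> kD; rewrite -addn1 -node_node node_time // /node expn1 c_node. Qed.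

Let time_lt k k' : k < k' < D * D -> time k < time k'.
Proof.
move=> kk; have /andP[k1 k2] := kk.
by rewrite !timeE ?(ltn_trans k1) // ltn_mul2r expn_gt0 M_gt0 c_lt.
Qed.

Let row_R (i : 'I_r.+1) (s : 'I_(M ^ n).+1) i' k k' : i <= i' <= r -> k < k' < D * D -> node m s = c k ->
  L (row i s) (R i' k').
Proof.
move=> /andP[ii ir] kk ns; apply/L_lt/row_lt_row; first by rewrite inordK.
have /andP[_ k2] := kk.
by rewrite timeE // -ltn_divLR ?expn_gt0 ?M_gt0 // -/(node m s) ns c_lt.
Qed.

Let R_row (i : 'I_r.+1) (s : 'I_(M ^ n).+1) i' k k' : i' <= i -> k' < k < D * D -> node m s = c k ->
  L (R i' k') (row i s).
Proof.
move=> ii kk ns; have /andP[k1 k2] := kk.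
apply/L_lt/row_lt_row; first by rewrite inordK // (leq_ltn_trans ii).
rewrite timeE ?(ltn_trans k1) //; apply: (@leq_trans (c k * M ^ m)).
  by rewrite ltn_mul2r expn_gt0 M_gt0 c_lt.
by rewrite -ns leq_trunc_div.
Qed.

Let R_R i i' k k' : i <= i' <= r -> k < k' < D * D -> L (R i k) (R i' k').
Proof.
move=> ii kk; have /andP[k1 k2] := kk; have /andP[i1 i2] := ii.
apply: (@row_R _ _ _ k) => //; last by rewrite node_time ?(ltn_trans k1).
by rewrite inordK // ltnS (leq_trans i1).
Qed.

Let X_row i i' k k' : i < i' <= r -> k < D * D -> k' < D * D -> L (X i k) (X i' k').
Proof.
move=> /andP[ii ir] kD kD'; apply/L_lt/col_lt_col_row; first by rewrite /= !node_timeS.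
by rewrite !inordK // ltnS ltnW // (leq_trans ii).
Qed.

Let X_time i k k' : k < k' < D * D -> L (X i k) (X i k').
Proof. by move=> kk; apply/L_lt/col_lt_col_time/time_lt. Qed.

Let in_rowsS p q p' q' k x : k < D * D -> p <= p' -> q' <= q ->
  in_rows m (c k) p' q' x -> in_rows m.+1 v p q x.
Proof.
move=> kD pp qq; case: x => [[[i s]|]|] //= /andP[/andP[pi iq] /eqP ns].
rewrite (leq_trans pp pi) (leq_trans iq qq) -addn1 -node_node ns /node expn1.
by rewrite c_node ?eqxx.
Qed.

Let in_topsS k x : k < D * D -> in_tops m (c k) x -> in_tops m.+1 v x.
Proof.
move=> kD; case: x => [[//|s]|[[j i] s]] /=.
  by move=> /eqP ns; rewrite -addn1 -node_node ns /node expn1 c_node.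
move=> /andP[jm /eqP ns]; rewrite ltnS (ltnW jm).
by rewrite -addn1 -node_node ns /node expn1 c_node ?eqxx.
Qed.

(* [L] delays row [h] against row [h - 1] by at least three children. *)
Let crossing h :=
  exists k k', [/\ k + 3 <= k', k' < D * D & L (R h.-1 k') (R h k)].

(** The lower rows of child [k'.-1] come before [R h.-1 k'], the upper rows of child [k.+1] after
    [R h k]. The right ends are in the opposite order because [k + 3 <= k'] gives [k.+1 < k'.-1]. *)
Let nest_split p h q : p < h -> h < q -> q <= r.+1 -> crossing h ->
  nest_at m.+1 v p q (rho p h + rho h q).
Proof.
move=> ph hq qr [k [k' [kk kD cr]]].
have k'D : k'.-1 < D * D by lia.
have kD' : k.+1 < D * D by lia.
have [|es nes [<- /allP hes]] := c_nest k'D (p := p) (q := h); first lia.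
have [|fs nfs [<- /allP hfs]] := c_nest kD' (p := h) (q := q); first lia.
exists (es ++ fs).
  apply: nest_cat => // e f /hes/andP[e1 e2] /hfs/andP[f1 f2].
  apply/andP; split; last by apply: in_tops_lt f2 e2 _; apply: c_lt; lia.
  case: e f e1 f1 {e2 f2} => [[[[i s]|?]|?] e2] [[[[i' s']|?]|?] f2] //=.
  move=> /andP[/andP[pi ih] /eqP ns] /andP[/andP[hi iq] /eqP ns'].
  apply: (L_tr (y := R h.-1 k')); first by apply: row_R ns; lia.
  by apply: L_tr cr _; apply: R_row ns'; lia.
rewrite size_cat all_cat; split=> //; apply/andP; split; apply/allP => e.
  by move=> /hes/andP[e1 e2]; rewrite (in_rowsS k'D _ _ e1) ?(in_topsS k'D e2) // ltnW.
by move=> /hfs/andP[e1 e2]; rewrite (in_rowsS kD' _ _ e1) ?(in_topsS kD' e2) // ltnW.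
Qed.

Section Aligned.
Context (p q : nat) (q_le : q <= r.+1).
Context (no_crossing : forall h, p < h < q -> ~ crossing h).

Let R_pred h k k' : p < h < q -> k + 3 <= k' -> k' < D * D -> L (R h k) (R h.-1 k').
Proof.
move=> ph kk kD; apply/negPn/negP => nL; apply: (no_crossing ph).
exists k, k'; split=> //; have: R h k != R h.-1 k'.
  apply/eqP => -[] /(congr1 val) /=; rewrite !inordK; lia.
by move=> /L_total; rewrite (negPf nL).
Qed.

Let R_down i t k : p <= i -> i + t < q -> k + 3 * t + 1 < D * D ->
  L (R (i + t) k) (R i (k + 3 * t + 1)).
Proof.
elim: t k => [|t IH] k pi iq kD; first by rewrite addn0; apply: R_R; lia.
have := IH (k + 3); rewrite (_ : k + 3 + 3 * t + 1 = k + 3 * t.+1 + 1); last lia.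
move=> {}IH; apply: (L_tr (y := R (i + t) (k + 3))); last by apply: IH; lia.
by have := @R_pred (i + t.+1) k (k + 3); rewrite addnS /=; apply; lia.
Qed.

Let R_aligned i i' k k' : p <= i < q -> p <= i' < q -> k + 3 * r + 1 < k' < D * D ->
  L (R i k) (R i' k').
Proof.
move=> ii ii' kk; have [le_ii|lt_ii] := leqP i i'; first by apply: R_R; lia.
rewrite -(subnKC (ltnW lt_ii)); apply: (L_tr (y := R i' (k + 3 * (i - i') + 1))).
  by apply: R_down; lia.
by apply: R_R; lia.
Qed.

(** Descending one row costs three children, so the total drift is at most [3 * r + 1] children,
    less than the gap between two samples. *)
Lemma rows_aligned k k' x y : k < k' < D ->
  in_rows m (c (D * k)) p q x -> in_rows m (c (D * k')) p q y -> L x y.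
Proof.
move=> kk; have kkD : D * k + D <= D * k' by rewrite -mulnSr leq_mul2l; lia.
have kD : D * k' < D * D by rewrite ltn_mul2l; lia.
case: x y => [[[i s]|?]|?] [[[i' s']|?]|?] //=.
move=> /andP[pi /eqP ns] /andP[pi' /eqP ns'].
apply: (L_tr (y := R i (D * k).+1)); first by apply: row_R ns; lia.
apply: (L_tr (y := R i' (D * k').-1)); first by apply: R_aligned => //; lia.
by apply: R_row ns'; lia.
Qed.

End Aligned.

(** The samples of row [i] in column [m] run from [X i 0] to [X i (D * D.-1)]. If neither [above]
    nor [below] holds, this span overlaps that of the right ends of child [D * g]. *)
Let above g i := forall y, in_tops m (c (D * g)) y -> L y (X i 0).
Let below g i := forall y, in_tops m (c (D * g)) y -> L (X i (D * D.-1)) y.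

Let tops_X u y i k : in_tops m u y -> y != X i k.
Proof. by apply: contraTneq => -> /=; rewrite ltnn. Qed.

Let not_above g i : ~ above g i -> exists2 y, in_tops m (c (D * g)) y & L (X i 0) y.
Proof.
move=> /existsNP[y /not_implyP[yt /negP nL]]; exists y => //.
by have := L_total (tops_X i 0 yt); rewrite (negPf nL).
Qed.

Let not_below g i :
  ~ below g i -> exists2 y, in_tops m (c (D * g)) y & L y (X i (D * D.-1)).
Proof.
move=> /existsNP[y /not_implyP[yt /negP nL]]; exists y => //.
by have := L_total (tops_X i (D * D.-1) yt); rewrite (negPf nL) orbF.
Qed.

(* If two rows were straddled for every [g], then the right ends of different
   children would reach across different boundaries between the rows of column
   [m], and there are too few boundaries. *)
Lemma straddled_row : exists g phi, r.+2 <= g <= 2 * r + 3 /\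
  forall i, i <= r -> i != phi -> above g i \/ below g i.
Proof.
pose bad g i := ~ above g i /\ ~ below g i.
have [[g [g_lo g_hi nbad]]|all_bad] := pselect (exists g, [/\ r.+2 <= g, g <= 2 * r + 3 &
  ~ exists i i', [/\ i < i', i' <= r, bad g i & bad g i']]).
  have good i i' : i < i' -> i' <= r -> ~ bad g i \/ ~ bad g i'.
    by move=> ii ir; apply: contrapT => /not_orP[/contrapT b /contrapT b']; apply: nbad; exists i, i'.
  have ok i : ~ bad g i -> above g i \/ below g i.
    by move=> nb; apply: contrapT => /not_orP.
  have [[phi [phi_le bphi]]|none] := pselect (exists i, i <= r /\ bad g i).
    exists g, phi; split=> [|i ir nphi]; first lia.
    by apply: ok => bi; case: (ltngtP i phi) nphi => // /good[].
  exists g, 0; split=> [|i ir _]; first lia.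
  by apply: ok => bi; apply: none; exists i.
have /choice[f hf] (g : 'I_r.+2) : exists i : 'I_r.+1, exists i',
    [/\ i < i', i' <= r, bad (r.+2 + g) i & bad (r.+2 + g) i'].
  apply: contrapT => nb; apply: all_bad; exists (r.+2 + g); split; [lia|have := ltn_ord g; lia|].
  move=> [i [i' [ii ir bi bi']]]; apply: nb.
  by exists (Ordinal (leq_ltn_trans (ltnW ii) (ir : i' < r.+1))), i'.
suff /leq_card : injective f by rewrite !card_ord ltnn.
have lt_f (g g' : 'I_r.+2) : g < g' -> f g != f g'.
  move=> gg; apply/eqP => fgg.
  (* A cycle arises: [y'] precedes the end of row [f g'], this the start of the higher row [i'],
     this [y], and [y] precedes [y']. *)
  have [i' [ii ir _ [/not_above[y yt Ly] _]]] := hf g.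
  have [_ [_ _ [_ /not_below[y' yt' Ly']] _]] := hf g'.
  have kD : D * (r.+2 + g') < D * D by rewrite ltn_mul2l; have := ltn_ord g'; lia.
  have lt_gg : D * (r.+2 + g) < D * (r.+2 + g') < D * D by rewrite kD ltn_mul2l; lia.
  have yy := in_tops_lt yt yt' (c_lt lt_gg).
  have lt_X : L (X (f g') (D * D.-1)) (X i' 0).
    by apply: X_row; rewrite -?fgg ?ii //; lia.
  by have := L_tr Ly' (L_tr lt_X (L_tr Ly yy)); rewrite L_irr.
move=> g g' fgg; case: (ltngtP g g') => [/lt_f|/lt_f|/val_inj //]; by rewrite fgg eqxx.
Qed.

(** Around the rainbow of child [D * g] go edges from earlier samples, for the rows [above] it;
    inside go edges from later samples, for the rows [below] it. *)
Lemma nest_aligned g phi p q : r.+2 <= g <= 2 * r + 3 ->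
  (forall i, i <= r -> i != phi -> above g i \/ below g i) ->
  p < q -> q <= r.+1 -> (forall h, p < h < q -> ~ crossing h) ->
  nest_at m.+1 v p q (rho p q + (q - p - (p <= phi < q))).
Proof.
move=> g_bnd g_phi pq qr nocr.
have aligned := rows_aligned qr nocr.
have gD : D * g < D * D by rewrite ltn_mul2l; lia.
have [|es nes [<- /allP hes]] := c_nest gD (p := p) (q := q); first by rewrite pq.
pose edge t i := (R i (D * t i), X i (D * t i)).
have R_in t i : t < D -> p <= i < q -> in_rows m (c (D * t)) p q (R i (D * t)).
  move=> tD ii; have tD' : D * t < D * D by rewrite ltn_mul2l; lia.
  by rewrite /= node_time // eqxx inordK ?ii //; lia.
have X_in t i : t < D -> p <= i < q -> in_tops m.+1 v (X i (D * t)).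
  move=> tD ii; have tD' : D * t < D * D by rewrite ltn_mul2l; lia.
  by rewrite /= ltnSn node_timeS // eqxx.
have nest_edges t s : (forall i, t i < D) -> (forall i i', i' < i <= r -> t i < t i') ->
    pairwise (fun i i' => i' < i) s -> {in s, forall i, p <= i < q} -> nest L (map (edge t) s).
  move=> tD t_anti; elim: s => // i s IH /= /andP[/allP ltsi /IH{}IH] sG.
  have iG : p <= i < q by apply: sG; rewrite mem_head.
  rewrite /nest /= cover_row_col //=.
  have /andP[-> ->] : nest L (map (edge t) s) by apply: IH => j js; apply: sG; rewrite inE js orbT.
  rewrite andbT; apply/allP => _ /mapP[j js ->]; rewrite /nested /=.
  have ji := ltsi _ js; have jG : p <= j < q by apply: sG; rewrite inE js orbT.
  apply/andP; split.
    apply: (aligned (t i) (t j)); rewrite ?R_in ?tD ?andbT //; apply: t_anti; lia.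
  by apply: X_row; rewrite ?ltn_mul2l ?tD //; lia.
pose s := [seq i <- rev (iota p (q - p)) | i != phi].
have s_mem i : i \in s -> p <= i < q /\ i != phi.
  by rewrite mem_filter mem_rev mem_iota subnKC ?(ltnW pq) // => /andP[-> ->].
have s_dec a : pairwise (fun i i' => i' < i) (filter a s).
  do 2!apply: pairwise_filter; rewrite -sorted_pairwise ?rev_sorted ?iota_ltn_sorted //.
  by move=> y x z yx zy; apply: ltn_trans yx.
pose us := [seq i <- s | `[< above g i >]]; pose ds := [seq i <- s | ~~ `[< above g i >]].
(* Both decrease, so that higher rows lie outside. The values of [tu] lie strictly between 0 and
   [g], those of [td] strictly between [g] and [D.-1]. *)
pose tu i := r.+1 - i; pose td i := 3 * r + 4 - i.
have us_in i : i \in us -> [/\ p <= i < q, i <= r & above g i].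
  rewrite mem_filter => /andP[/asboolP ab /s_mem[iG _]]; split=> //; lia.
have ds_in i : i \in ds -> [/\ p <= i < q, i <= r & below g i].
  rewrite mem_filter => /andP[/asboolP nab /s_mem[iG nphi]].
  have ir : i <= r by lia.
  by split=> //; case: (g_phi _ ir nphi).
have D_gt0 : 0 < D by rewrite /D; lia.
have far t i : t < D -> 0 < t -> L (X i 0) (X i (D * t)).
  by move=> tD t_gt0; apply: X_time; rewrite muln_gt0 ltn_mul2l D_gt0 t_gt0.
have near t i : t < D.-1 -> L (X i (D * t)) (X i (D * D.-1)).
  by move=> tD; apply: X_time; rewrite !ltn_mul2l D_gt0 tD ltn_predL.
have above_far y t i : in_tops m (c (D * g)) y -> above g i -> t < D -> 0 < t -> L y (X i (D * t)).
  by move=> yt ab tD t_gt0; apply: L_tr (ab _ yt) (far _ _ tD t_gt0).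
have below_near y t i : in_tops m (c (D * g)) y -> below g i -> t < D.-1 -> L (X i (D * t)) y.
  by move=> yt be tD; apply: L_tr (near _ _ tD) (be _ yt).
have g_tops : in_tops m (c (D * g)) (top (time (D * g))) by rewrite /= node_time.
exists (map (edge tu) us ++ es ++ map (edge td) ds).
  apply: nest_cat; [|apply: nest_cat => //|].
  - apply: nest_edges => [i|i i'|| i /us_in[] //]; rewrite /tu; [lia|lia|exact: s_dec].
  - apply: nest_edges => [i|i i'|| i /ds_in[] //]; rewrite /td; [lia|lia|exact: s_dec].
  - move=> e _ /hes/andP[e1 e2] /mapP[i /ds_in[iG ir be] ->]; apply/andP; split=> /=.
      by apply: (aligned g (td i)) => //; [|apply: R_in]; rewrite /td; lia.
    by apply: below_near => //; rewrite /td; lia.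
  - move=> _ f /mapP[i /us_in[iG ir ab] ->]; rewrite mem_cat => /orP[/hes/andP[f1 f2]|].
      apply/andP; split=> /=.
        by apply: (aligned (tu i) g) => //; [|apply: R_in]; rewrite /tu; lia.
      by apply: above_far => //; rewrite /tu; lia.
    move=> /mapP[j /ds_in[jG jr be] ->]; apply/andP; split=> /=.
      by apply: (aligned (tu i) (td j)); [|apply: R_in|apply: R_in] => //; rewrite /tu /td; lia.
    (* This element separates the right ends of the two groups even when [es] is empty. *)
    apply: (L_tr (y := top (time (D * g)))).
      by apply: below_near => //; rewrite /td; lia.
    by apply: above_far => //; rewrite /tu; lia.
have size_s : size s + (p <= phi < q) = q - p.
  rewrite size_filter -[RHS](size_iota p) -size_rev -(count_predC (pred1 phi)) addnC.
  by rewrite count_uniq_mem ?rev_uniq ?iota_uniq // mem_rev mem_iota subnKC ?(ltnW pq).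
split.
  rewrite !size_cat !size_map addnCA; congr (_ + _).
  by rewrite -size_s addnK /us /ds [in LHS]size_filter [size [seq _ <- _ | ~~ _]]size_filter count_predC.
rewrite !all_cat; apply/and3P; split; apply/allP => e.
- move=> /mapP[i /us_in[iG ir _] ->].
  have tD : tu i < D by rewrite /tu; lia.
  have tD' : D * tu i < D * D by rewrite ltn_mul2l D_gt0 ?tD.
  apply/andP; split; last exact: X_in.
  exact: in_rowsS tD' (leqnn p) (leqnn q) (R_in _ _ tD iG).
- by move=> /hes/andP[e1 e2]; rewrite (in_rowsS gD _ _ e1) ?(in_topsS gD e2).
- move=> /mapP[i /ds_in[iG ir _] ->].
  have tD : td i < D by rewrite /td; lia.
  have tD' : D * td i < D * D by rewrite ltn_mul2l D_gt0 ?tD.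
  apply/andP; split; last exact: X_in.
  exact: in_rowsS tD' (leqnn p) (leqnn q) (R_in _ _ tD iG).
Qed.

Lemma nest_step : exists phi, forall p q, p < q -> q <= r.+1 ->
  nest_at m.+1 v p q (rho p q + (q - p - (p <= phi < q))) \/
  exists2 h, p < h < q & nest_at m.+1 v p q (rho p h + rho h q).
Proof.
have [g [phi [g_bnd g_phi]]] := straddled_row; exists phi => p q pq qr.
have [[h [ph cr]]|no_cr] := pselect (exists h, p < h < q /\ crossing h).
  by right; exists h => //; have /andP[ph1 ph2] := ph; apply: nest_split.
by left; apply: nest_aligned g_bnd g_phi pq qr _ => h ph cr; apply: no_cr; exists h.
Qed.

End Step.
End Extension.

Lemma pigeonhole (T : finType) (K N : nat) (f : nat -> T) : 0 < N -> K * #|T| <= N ->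
  exists x c, (forall k k', k < k' < K -> c k < c k') /\
    forall k, k < K -> c k < N /\ f (c k) = x.
Proof.
move=> N_gt0 KN.
have [x xK] : exists x, K <= #|[pred t : 'I_N | f t == x]|.
  apply: contrapT => /forallNP small.
  have : N <= \sum_x #|[pred t : 'I_N | f t == x]|.
    rewrite -{1}(card_ord N) -sum1_card (partition_big (fun t : 'I_N => f t) xpredT) //=.
    by apply: leq_sum => x _; rewrite sum1_card.
  have T_gt0 : 0 < #|T| by apply/card_gt0P; exists (f 0).
  case: K KN small => [|K] KN small; first by have := small (f 0).
  have : \sum_x #|[pred t : 'I_N | f t == x]| <= \sum_(x : T) K.
    by apply: leq_sum => x _; have /negP := small x; rewrite -ltnNge.
  rewrite sum_nat_const => le1 le2; have := leq_trans KN (leq_trans le2 le1).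
  by rewrite mulnC leq_mul2l ltnn orbF eqn0Ngt T_gt0.
pose s := [seq val t | t <- enum [pred t : 'I_N | f t == x]].
have s_sorted : sorted ltn s.
  apply: (subseq_sorted ltn_trans _ (iota_ltn_sorted 0 N)).
  by rewrite -val_enum_ord; apply: map_subseq; rewrite enumT; apply: filter_subseq.
have size_s : K <= size s by rewrite /s size_map -cardE.
exists x, (nth 0 s); split=> [k k' /andP[kk kK]|k kK].
  by apply: (sorted_ltn_nth ltn_trans 0 s_sorted k k') => //; rewrite inE; lia.
have : nth 0 s k \in s by rewrite mem_nth // (leq_trans kK).
by move=> /mapP[t]; rewrite mem_enum inE => /eqP ft ->; split; first exact: ltn_ord.
Qed.

(** * Counting edges over partitions of the rows *)

Section Cuts.
Context (r : nat).

(** An increasing list [p :: s] stands for a partition of rows into the intervals between successive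
    cuts. *)
Fixpoint cut_sum (rho : nat -> nat -> nat) p s :=
  if s is q :: s' then rho p q + cut_sum rho q s' else 0.

Lemma cut_sum1 p s : cut_sum (fun _ _ => 1) p s = size s.
Proof. by elim: s p => //= q s IH p; rewrite IH. Qed.

(* [gain k] bounds from below what one level adds when there are [k] sets of
   rows: either none of them is split and [r] edges are won, or the number of
   sets grows and each unsplit set, except perhaps one, wins an edge. *)
Definition gain k := maxn 1 (minn k.-1 r).

(** Level 0 yields one edge per set; the sum allows for one split per level on the way down. *)
Definition bound m k := k + \sum_(t < m) gain (k + t).

Lemma boundS m k : bound m.+1 k = bound m k + gain (k + m).
Proof. by rewrite /bound big_ord_recr /= addnA. Qed.

Lemma bound_unsplit m k : 0 < r -> bound m.+1 k <= bound m k + r.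
Proof. by move=> r_gt0; rewrite boundS leq_add2l /gain; lia. Qed.

(** More sets never lower a later gain, and the leading term rises by [d]; so it suffices that
    [d + (k - d.+1)] covers [gain k]. *)
Lemma bound_split m k d : 0 < d <= k -> bound m.+1 k <= bound m (k + d) + (k - d.+1).
Proof.
move=> dk; rewrite /bound big_ord_recl addn0.
have : \sum_(t < m) gain (k + lift ord0 t) <= \sum_(t < m) gain (k + d + t).
  by apply: leq_sum => t _; rewrite /= /bump /gain; lia.
have : gain k <= d + (k - d.+1) by rewrite /gain; lia.
by move=> /=; lia.
Qed.

(** Here [d] counts the split sets, [u] the rows in unsplit sets, and [e] is 1 if [phi] is such a
    row. The last clause carries through the induction that [phi] lies in one set only. *)
Lemma cut_sum_refine rho rho' phi :
  (forall p q, p < q -> q <= r.+1 -> rho' p q = rho p q + (q - p - (p <= phi < q)) \/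
     exists2 h, p < h < q & rho' p q = rho p h + rho h q) ->
  forall s p, path ltn p s -> last p s <= r.+1 ->
  exists s' d u e,
    [/\ path ltn p s', last p s' = last p s, size s' = size s + d &
        cut_sum rho p s' + u = cut_sum rho' p s + e] /\
    [/\ d <= size s, size s - d <= u, (d = 0 -> u = last p s - p), e <= minn u 1 &
        (phi < p -> e = 0)].
Proof.
move=> rhoE; elim=> [|q s IH] p /=.
  move=> _ _; exists [::], 0, 0, 0; split; split=> //=; lia.
move=> /andP[pq path_s] last_s.
have q_last : q <= last q s.
  by elim: s q path_s {IH pq last_s} => //= q' s IHs q /andP[qq /IHs]; lia.
have [s' [d [u [e [[path_s' last_s' size_s' sum_s'] [du ud u0 e1 ephi]]]]]] := IH q path_s last_s.
have [rpq|[h /andP[ph hq] rpq]] := rhoE p q pq (leq_trans q_last last_s).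
  exists (q :: s'), d, (u + (q - p)), (e + (p <= phi < q)).
  split; split=> //=; rewrite ?pq ?size_s' ?rpq //; lia.
exists [:: h, q & s'], d.+1, u, e.
split; split=> //=; rewrite ?ph ?hq ?size_s' ?rpq //; lia.
Qed.

Lemma cut_sum_bound rho rho' phi B m : 0 < r ->
  (forall p q, p < q -> q <= r.+1 -> rho' p q = rho p q + (q - p - (p <= phi < q)) \/
     exists2 h, p < h < q & rho' p q = rho p h + rho h q) ->
  (forall s, path ltn 0 s -> last 0 s = r.+1 -> minn B (bound m (size s)) <= cut_sum rho 0 s) ->
  forall s, path ltn 0 s -> last 0 s = r.+1 -> minn B (bound m.+1 (size s)) <= cut_sum rho' 0 s.
Proof.
move=> r_gt0 rhoE rho_ge s path_s last_s.
have [|s' [d [u [e [[path_s' last_s' size_s' sum_s'] [du ud u0 e1 _]]]]]] :=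
  cut_sum_refine rhoE path_s; first by rewrite last_s.
have := rho_ge s' path_s' (etrans last_s' last_s); rewrite size_s'.
case: (posnP d) => [d0|d_gt0].
  have := u0 d0; have := bound_unsplit m (size s) r_gt0; rewrite last_s d0 addn0; lia.
have := @bound_split m (size s) d; rewrite d_gt0 du => /(_ isT); lia.
Qed.

Lemma cut_sum_min rho rho' B :
  (forall p q, p < q -> q <= r.+1 -> rho' p q = minn B (rho p q)) ->
  forall s p, path ltn p s -> last p s <= r.+1 -> minn B (cut_sum rho p s) <= cut_sum rho' p s.
Proof.
move=> rhoE; elim=> [|q s IH] p /=; first by rewrite minn0.
move=> /andP[pq path_s] last_s.
have q_last : q <= last q s.
  by elim: s q path_s {IH pq last_s} => //= q' s IHs q /andP[qq /IHs]; lia.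
have := IH q path_s last_s; rewrite rhoE // ?(leq_trans q_last) //; lia.
Qed.

(** The gains are 1, 1, 2, ..., [r] on the first [r.+1] levels and [r] from then on. *)
Lemma bound_ge k : 0 < r -> 4 + r * (2 * (r.+1 + k)) <= 2 * bound (r.+1 + k) 1 + r * r.+1.
Proof.
move=> r_gt0; elim: k => [|k IH].
  suff sumE l : l <= r -> 2 * \sum_(t < l.+1) gain (1 + t) = 2 + l * l.+1.
    by rewrite addn0 /bound mulnDr sumE //; lia.
  elim: l => [|l IH] lr; first by rewrite big_ord1 /gain /=; lia.
  rewrite big_ord_recr /= mulnDr IH ?(ltnW lr) // /gain; nia.
have -> : bound (r.+1 + k.+1) 1 = bound (r.+1 + k) 1 + r by rewrite addnS boundS /gain; lia.
lia.
Qed.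

End Cuts.

(** In each residue class modulo 3 there remains a quadratic in [r] with negative discriminant,
    thanks to the additive 4 of [bound_ge]. *)
Lemma bound_square w : 3 < w -> w ^ 2 <= 8 * bound (w %/ 3) (w - (w %/ 3).+1) 1.
Proof.
move=> w_gt3; have w_div := divn_eq w 3; have w_mod := ltn_pmod w (isT : 0 < 3).
set r := w %/ 3 in w_div *.
have r_gt0 : 0 < r by rewrite divn_gt0 // ltnW.
have -> : w - r.+1 = r.+1 + (w - 2 * r.+1) by lia.
have := bound_ge (w - 2 * r.+1) r_gt0.
have w2 : r.+1 + (w - 2 * r.+1) = w - r.+1 by lia.
rewrite w2; move: (bound _ _ _) => b b_ge.
have w_mod3 : w %% 3 = 0 \/ w %% 3 = 1 \/ w %% 3 = 2 by lia.
have [n nE] : exists n, w - r.+1 = n by exists (w - r.+1).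
rewrite nE in b_ge.
case: w_mod3 w_div => [|[]] -> w_div.
- have n2 : n + 1 = 2 * r by lia.
  have r2 : 1 < r by lia.
  nia.
- have n2 : n = 2 * r by lia.
  nia.
- have n2 : n = 2 * r + 1 by lia.
  nia.
Qed.

(** Sizes are capped at [B] to have finitely many colours [f]. Then [M] is large enough for
    [(3 * r + 6) * (3 * r + 6)] children of each node to share a colour, as [nest_step] requires. *)
Lemma nest_levels r n M B (L : rel (elt r n M : finPOrderType _)) :
  0 < r -> 0 < n -> 0 < M -> linear_extension L ->
  (3 * r + 6) * (3 * r + 6) * #|{ffun 'I_r.+2 * 'I_r.+2 -> 'I_B.+1}| <= M ->
  forall m, m <= n -> forall v, v < M ^ (n - m) ->
  exists f : {ffun 'I_r.+2 * 'I_r.+2 -> 'I_B.+1},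
    (forall p q, p < q <= r.+1 -> nest_at L m v p q (f (inord p, inord q))) /\
    forall s, path ltn 0 s -> last 0 s = r.+1 ->
      minn B (bound r m (size s)) <= cut_sum (fun p q => f (inord p, inord q)) 0 s.
Proof.
move=> r_gt0 n_gt0 M_gt0 L_ext M_big; elim=> [|m IH] mn v v_lt.
  exists [ffun=> inord (minn B 1)]; split=> [p q pq|s path_s last_s].
    rewrite ffunE inordK ?ltnS ?geq_minl //.
    apply: nest_at_le (geq_minr _ _) _; apply: nest_at0 => //.
    by rewrite -[n]subn0 ltnW.
  rewrite /bound big_ord0 addn0.
  rewrite -(cut_sum1 0 s).
  apply: (@cut_sum_min r) => //; last by rewrite last_s.
  by move=> p q pq qr; rewrite ffunE inordK ?ltnS ?geq_minl.
have child_lt t : t < M -> v * M + t < M ^ (n - m).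
  move=> tM; rewrite -(subnSK mn) expnSr; apply: leq_trans (leq_mul v_lt (leqnn M)).
  by rewrite mulSn addnC -addSn leq_add2r.
have /choice[F hF] t : exists f : {ffun 'I_r.+2 * 'I_r.+2 -> 'I_B.+1}, t < M ->
    (forall p q, p < q <= r.+1 -> nest_at L m (v * M + t) p q (f (inord p, inord q))) /\
    forall s, path ltn 0 s -> last 0 s = r.+1 ->
      minn B (bound r m (size s)) <= cut_sum (fun p q => f (inord p, inord q)) 0 s.
  have [tM|] := ltnP t M; last by exists [ffun=> ord0].
  by have [f hf] := IH (ltnW mn) _ (child_lt t tM); exists f.
have [f [c [c_lt c_f]]] := pigeonhole F M_gt0 M_big.
pose rho p q : nat := f (inord p, inord q).
have [|||phi rhoE] := @nest_step r n M M_gt0 n_gt0 L L_ext m v (fun k => v * M + c k) rho mn v_lt.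
- by move=> k k' kk; rewrite ltn_add2l c_lt.
- by move=> k kD; have [ckM _] := c_f k kD; rewrite divnMDl // divn_small ?addn0.
- by move=> k kD p q pq; have [ckM Fck] := c_f k kD; have [+ _] := hF _ ckM; rewrite Fck; apply.
have rho_ge s : path ltn 0 s -> last 0 s = r.+1 -> minn B (bound r m (size s)) <= cut_sum rho 0 s.
  have D_gt0 : 0 < (3 * r + 6) * (3 * r + 6) by rewrite muln_gt0; lia.
  by have [ck0 Fc0] := c_f 0 D_gt0; have [_ +] := hF _ ck0; rewrite Fc0; apply.
have /choice[rho' rho'E] (pq : nat * nat) : exists k, pq.1 < pq.2 -> pq.2 <= r.+1 ->
    nest_at L m.+1 v pq.1 pq.2 k /\
    (k = rho pq.1 pq.2 + (pq.2 - pq.1 - (pq.1 <= phi < pq.2)) \/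
     exists2 h, pq.1 < h < pq.2 & k = rho pq.1 h + rho h pq.2).
  case: pq => p q /=; have [pq|] := ltnP p q; last by exists 0.
  have [qr|] := leqP q r.+1; last by exists 0.
  have [nes|[h ph nes]] := rhoE p q pq qr.
    by exists (rho p q + (q - p - (p <= phi < q))) => _ _; split=> //; left.
  by exists (rho p h + rho h q) => _ _; split=> //; right; exists h.
pose g := [ffun pq : 'I_r.+2 * 'I_r.+2 => inord (minn B (rho' (val pq.1, val pq.2))) : 'I_B.+1].
have gE p q : p < q -> q <= r.+1 -> g (inord p, inord q) = minn B (rho' (p, q)) :> nat.
  move=> pq qr; rewrite ffunE inordK ?ltnS ?geq_minl //= !inordK //.
  by rewrite ltnS (leq_trans (ltnW pq)).
exists g; split=> [p q /andP[pq qr]|s path_s last_s].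
  rewrite gE //; have [nes _] := rho'E (p, q) pq qr.
  exact: nest_at_le (geq_minr _ _) nes.
have rho'_ge : minn B (bound r m.+1 (size s)) <= cut_sum (fun p q => rho' (p, q)) 0 s.
  by apply: (cut_sum_bound r_gt0 _ rho_ge) => // p q pq qr; have [_ ?] := rho'E (p, q) pq qr; eauto.
apply: leq_trans (cut_sum_min gE path_s _); last by rewrite last_s.
by rewrite leq_min geq_minl.
Qed.

(** * Choice of the parameters *)

Local Open Scope ring_scope.

Theorem theorem1 (w : nat) (hw : (3 < w)%N) :
  exists (d : Order.disp_t) (P : finPOrderType d),
    width P = w /\ (w%:R ^+ 2 / 8%:R <= (queue_number P)%:R :> rat).
Proof.
set r := (w %/ 3)%N; set n := (w - r.+1)%N.
have r_gt0 : (0 < r)%N by rewrite divn_gt0 // ltnW.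
have wE : (r.+1 + n = w)%N by rewrite subnKC // /r; lia.
have n_gt0 : (0 < n)%N by rewrite /n /r; lia.
pose B := bound r n 1.
pose M := ((3 * r + 6) * (3 * r + 6) * #|{ffun 'I_r.+2 * 'I_r.+2 -> 'I_B.+1}|)%N.
have M_gt1 : (1 < M)%N.
  have : (0 < #|{ffun 'I_r.+2 * 'I_r.+2 -> 'I_B.+1}|)%N by apply/card_gt0P; exists [ffun=> ord0].
  by rewrite /M; nia.
exists _, (elt r n M); split; first by rewrite width_elt.
have qn : (B <= queue_number (elt r n M : finPOrderType _))%N.
  apply: queue_number_ge => L L_ext.
  have [|f [f_nest f_ge]] := nest_levels r_gt0 n_gt0 (ltnW M_gt1) L_ext (leqnn M) (leqnn n) (v := 0).
    by rewrite subnn.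
  have [es nes [size_es _]] := f_nest 0 r.+1 (leqnn r.+1).
  exists es => //; rewrite size_es.
  (* The partition with a single set gives [bound r n 1], which is [B] itself, so the cap loses
     nothing. *)
  by have /= := f_ge [:: r.+1] isT erefl; rewrite addn0 minnn.
rewrite ler_pdivrMr ?ltr0n // -natrX -natrM ler_nat mulnC.
by apply: leq_trans (bound_square hw) _; rewrite leq_mul2l.
Qed.
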